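(* There exist an upper semicontinuous function $F\colon [0,1]\to 2^{[0,1]}$ and a point $t\in[0,1]$ such that $\mathcal{O}_F(t)$ is an infinite-dimensional continuum.
   Context: A continuum is a connected compact metric space. $2^{[0,1]}$ denotes the family of all nonempty closed subsets of $[0,1]$. A function $F\colon X\to 2^X$ (here $X=[0,1]$) is upper semicontinuous if for each $x\in X$ and every open subset $V$ of $X$ with $F(x)\subseteq V$, there is an open subset $U$ of $X$ with $x\in U$ and $F(y)\subseteq V$ for all $y\in U$. $\mathbb N=\{1,2,3,\ldots\}$ and $X^{\mathbb N}$ carries the product topology. For $z\in X$, the orbit set of $z$ is $\mathcal{O}_F(z)=\{(x_n)_{n\in\mathbb N}\in X^{\mathbb N} : x_1=z \text{ and } x_{n+1}\in F(x_n) \text{ for each } n\in\mathbb N\}$, regarded as a subspace of $X^{\mathbb N}$. Dimension is the usual topological dimension of separable metric spaces. *)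

(* Defs.v *)
From HB Require Import structures.
From mathcomp Require Import all_boot all_order all_algebra.
From mathcomp Require Import all_classical all_reals topology normedtype.

Set Implicit Arguments.
Unset Strict Implicit.
Unset Printing Implicit Defensive.

Import Order.TTheory GRing.Theory Num.Theory.
Import numFieldNormedType.Exports.

Local Open Scope classical_set_scope.
Local Open Scope card_scope.
Local Open Scope ring_scope.

(* A set coerced to a type by [set_type] carries the subspace topology. *)
Definition unit_interval (R : realType) : topologicalType :=
  set_type `[0 : R, 1]%classic.

Section set_valued_functions.
Variable X : topologicalType.

Definition hyperspace : set (set X) := [set A | closed A /\ A !=set0].

Definition upper_semicontinuous (F : X -> set X) : Prop :=
  forall (x : X) (V : set X), open V -> F x `<=` V ->
    exists U : set X, [/\ open U, U x & forall y, U y -> F y `<=` V].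

(* The library's [nat] starts at 0, so [x 0%N] is the first term x_1;
   [{ptws nat -> X}] is the countable power of X with the product topology. *)
Definition orbit_set (F : X -> set X) (z : X) : set {ptws nat -> X} :=
  [set x | x 0%N = z /\ forall n, F (x n) (x n.+1)].

End set_valued_functions.

Definition metrizable (R : realType) (T : topologicalType) : Prop :=
  exists d : T -> T -> R,
    [/\ forall x y, d x y = 0 <-> x = y,
        forall x y, d x y = d y x,
        forall x y z, d x z <= d x y + d y z
      & forall (x : T) (A : set T),
          nbhs x A <-> exists2 e : R, 0 < e & [set y | d x y < e] `<=` A].

Definition continuum (R : realType) (T : topologicalType) : Prop :=
  [/\ metrizable R T, compact [set: T] & connected [set: T]].

(* Covering dimension, which for separable metrizable spaces agrees with the
   small and large inductive dimensions.  Covers are sets of subsets, so the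
   cardinality below counts distinct members containing x. *)
Definition open_cover (T : topologicalType) (U : set (set T)) : Prop :=
  U `<=` open /\ \bigcup_(A in U) A = [set: T].

Definition dimension_le (T : topologicalType) (n : nat) : Prop :=
  forall U : set (set T), finite_set U -> open_cover U ->
    exists V : set (set T),
      [/\ finite_set V,
          open_cover V,
          forall B, V B -> exists2 A, U A & B `<=` A
        & forall x : T, [set B | V B /\ B x] #<= `I_n.+1].

Definition infinite_dimensional (T : topologicalType) : Prop :=
  forall n : nat, ~ dimension_le T n.

(* Main.v *)
Require Import Defs.
From HB Require Import structures.
From mathcomp Require Import all_boot all_order all_algebra.
From mathcomp Require Import zify lra.
From mathcomp Require Import all_classical all_reals topology normedtype.

(* The constant function F = [0,1] is upper semicontinuous and its orbit sets
   are copies of the Hilbert cube, so the point is the Lebesgue covering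
   theorem.  Suppose every member of an open cover of the cube misses, in each
   of the first N directions, one of the two opposite faces.  On a grid finer
   than the Lebesgue number, choose for each grid point a member of the cover
   containing the ball around it, and label the grid point by the first
   direction in which this member meets the lower face (N if there is none).
   This is a Sperner labelling, so some grid cell carries all the labels
   0, ..., N; the N+1 members chosen at these vertices are distinct and have a
   common point.
   Sperner's lemma for the cube is Stokes' theorem mod 2: the cochain counting
   the simplices that carry all the labels is a coboundary, and the
   triangulation of the cube is built one coordinate at a time from prisms. *)

Set Implicit Arguments.
Unset Strict Implicit.
Unset Printing Implicit Defensive.

Local Open Scope classical_set_scope.

(** * Cochains modulo 2 *)

Section mod2_cochains.
Variable V : eqType.
Implicit Types (phi psi : seq V -> bool) (w : V -> bool) (s : seq V).

(* A cochain is a boolean function on vertex sequences, addition mod 2 being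
   exclusive or: wedge w phi s is the sum over the positions j of
   w(s_j) * phi(s with s_j deleted). *)
Fixpoint wedge w phi s : bool :=
  if s is x :: s' then
    (w x && phi s') (+) wedge w (fun t => phi (x :: t)) s'
  else false.

Definition coboundary := wedge predT.

Lemma eq_in_wedge w w' phi phi' s :
  {in s, w =1 w'} -> phi =1 phi' -> wedge w phi s = wedge w' phi' s.
Proof.
elim: s phi phi' => [//|x s IH] phi phi' ew ephi /=.
rewrite ew ?mem_head// ephi (IH _ (fun t => phi' (x :: t))) // => y ys.
by apply: ew; rewrite inE ys orbT.
Qed.

Lemma wedgeD w phi psi s :
  wedge w (fun t => phi t (+) psi t) s = wedge w phi s (+) wedge w psi s.
Proof.
elim: s phi psi => [//|x s IH] phi psi /=.
by rewrite IH; case: (w x) => //=; case: (phi s); case: (psi s);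
  case: (wedge _ _ _); case: (wedge _ _ _).
Qed.

Lemma wedgeDl w w' phi s :
  wedge (fun x => w x (+) w' x) phi s = wedge w phi s (+) wedge w' phi s.
Proof.
elim: s phi => [//|x s IH] phi /=.
by rewrite IH; case: (w x); case: (w' x); case: (phi s);
  case: (wedge _ _ _); case: (wedge _ _ _).
Qed.

Lemma wedge0 w s : wedge w (fun=> false) s = false.
Proof. by elim: s => [//|x s /= ->]; rewrite andbF. Qed.

Lemma wedge0l phi s : wedge pred0 phi s = false.
Proof. by elim: s phi => [//|x s IH] phi /=; rewrite IH. Qed.

Lemma wedge_scale w (b : bool) phi s :
  wedge w (fun t => b && phi t) s = b && wedge w phi s.
Proof. by case: b => //=; exact: wedge0. Qed.

(** Both sides delete two distinct positions, one weighted by [w] and one by [w'], and the order is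
    immaterial. *)
Lemma wedgeC w w' phi s :
  wedge w (wedge w' phi) s = wedge w' (wedge w phi) s.
Proof.
elim: s phi => [//|x s IH] phi /=.
rewrite !wedgeD !wedge_scale IH.
by case: (w x && _); case: (w' x && _); case: (wedge _ _ _).
Qed.

(** Each pair of positions is deleted in two orders, and the two terms cancel. *)
Lemma wedgeK w phi s : wedge w (wedge w phi) s = false.
Proof.
elim: s phi => [//|x s IH] phi /=.
by rewrite wedgeD wedge_scale IH; case: (w x && _).
Qed.

Lemma wedge_true w phi s : wedge w phi s ->
  exists x t, [/\ x \in s, w x, phi t & {subset t <= s}].
Proof.
elim: s phi => [//|x s IH] phi /=.
case: (boolP (w x && phi s)) => [/andP[wx ps] _|_ /= /IH].
  by exists x, s; split=> //; rewrite ?mem_head // => y ys; rewrite inE ys orbT.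
move=> [y [t [ys wy pt ts]]]; exists y, (x :: t).
split => //; first by rewrite inE ys orbT.
by move=> z; rewrite !inE => /orP[->//|/ts ->]; rewrite orbT.
Qed.

Section labels.
Variable l : V -> nat.

(* The parity of the number of ways to pick vertices of s labelled
   n-1, ..., 0 so that no vertex is left over. *)
Fixpoint label_cochain n : seq V -> bool :=
  if n is n'.+1 then wedge (fun x => l x == n') (label_cochain n') else @nilp V.

Lemma label_cochain_true n s : label_cochain n s ->
  forall i, (i < n)%N -> exists2 x, x \in s & l x = i.
Proof.
elim: n s => [//|n IH] s /= /wedge_true[x [t [xs /eqP lx /IH Ht ts]]] i.
rewrite ltnS leq_eqVlt => /orP[/eqP ->|/Ht[y /ts ys ly]]; first by exists x.
by exists y.
Qed.

(** The label [m] is already one of the factors: commuting brings the two together, and [wedgeK]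
    cancels them. *)
Lemma wedge_label_cochain m n s : (m < n)%N ->
  wedge (fun x => l x == m) (label_cochain n) s = false.
Proof.
elim: n s => [//|n IH] s; rewrite ltnS leq_eqVlt => /orP[/eqP ->|mn] /=.
  exact: wedgeK.
rewrite wedgeC -[RHS](wedge0 (fun x => l x == n) s).
by apply: eq_in_wedge => // t; exact: IH.
Qed.

Lemma wedge_labels_lt m n s : (m <= n)%N ->
  wedge (fun x => l x < m)%N (label_cochain n) s = false.
Proof.
elim: m => [_|m IH mn]; first exact: wedge0l.
rewrite (@eq_in_wedge _ (fun x => (l x < m)%N (+) (l x == m)) _
  (label_cochain n)) //.
  by rewrite wedgeDl wedge_label_cochain // IH // ltnW.
by move=> x _ /=; rewrite ltnS; case: ltngtP.
Qed.

(* The coboundary is the sum over i of the wedges with the indicator of the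
   label i, and those with i < n vanish because wedge is alternating. *)
Lemma coboundary_label_cochain n s : {in s, forall x, l x <= n}%N ->
  coboundary (label_cochain n) s = label_cochain n.+1 s.
Proof.
move=> ls.
rewrite /coboundary (@eq_in_wedge _ (fun x => (l x < n)%N (+) (l x == n)) _
  (label_cochain n)) //.
  by rewrite wedgeDl wedge_labels_lt.
by move=> x /ls /=; case: ltngtP.
Qed.

End labels.
End mod2_cochains.

Lemma wedge_map (V W : eqType) (g : V -> W) w (phi : seq W -> bool) s :
  wedge w phi (map g s) = wedge (w \o g) (phi \o map g) s.
Proof. by elim: s phi => [//|x s IH] phi /=; rewrite IH. Qed.

Lemma label_cochain_map (V W : eqType) (g : V -> W) (l : W -> nat) n s :
  label_cochain l n (map g s) = label_cochain (l \o g) n s.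
Proof.
elim: n s => [|n IH] s /=; first by case: s.
by rewrite wedge_map; apply: eq_in_wedge.
Qed.

(** * The prism and its boundary *)

Section prism.
Variables V W : eqType.
Implicit Types (g h : V -> W) (phi psi : seq W -> bool) (s : seq V).

(* The sum of phi over the simplices g x_0 ... g x_j h x_j ... h x_m of the
   prism joining the images of s = x_0 ... x_m under g and h. *)
Fixpoint prism g h phi s : bool :=
  if s is x :: s' then
    phi [:: g x, h x & map h s'] (+) prism g h (fun t => phi (g x :: t)) s'
  else false.

Lemma prismD g h phi psi s :
  prism g h (fun t => phi t (+) psi t) s = prism g h phi s (+) prism g h psi s.
Proof.
elim: s phi psi => [//|x s IH] phi psi /=.
by rewrite IH addbACA.
Qed.

Lemma prism_true g h phi s : prism g h phi s ->
  exists2 t, phi t & {subset t <= map g s ++ map h s}.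
Proof.
elim: s phi => [//|x s IH] phi /=.
case: (boolP (phi _)) => [p _|_ /= /IH[t pt ts]].
  exists [:: g x, h x & map h s] => // y.
  rewrite !inE mem_cat inE => /or3P[->|->|->] //; rewrite ?orbT //.
exists (g x :: t) => // y; rewrite !inE mem_cat inE => /orP[->//|/ts].
by rewrite mem_cat => /orP[]->; rewrite ?orbT.
Qed.

(** Faces shared by consecutive simplices of the prism cancel, leaving top, bottom and side
    walls. *)
Lemma prism_coboundary g h psi s :
  prism g h (coboundary psi) s =
  psi (map h s) (+) psi (map g s) (+) coboundary (prism g h psi) s.
Proof.
rewrite /coboundary.
elim: s psi => [|x s IH] psi /=; first by rewrite addbb.
rewrite prismD IH wedgeD wedge_map /=.
rewrite (_ : wedge (predT \o h) _ s =
   wedge predT (fun t => psi [:: g x, h x & map h t]) s) //.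
by case: (psi (h x :: _)); case: (psi (g x :: map h s));
  case: (psi (g x :: map g s)); case: (prism g h psi s);
  case: (wedge _ (prism _ _ _) s); case: (wedge _ _ s).
Qed.

End prism.

(** * The triangulated cube and Sperner's lemma *)

Section cube.
Variable k : nat.
Implicit Types (N : nat) (v b : seq nat) (phi psi : seq (seq nat) -> bool).

(** [b] is the lowest corner of a unit cell of the grid; its length is left free. *)
Definition cell N b v : bool :=
  (size v == N) &&
  all (fun i => [&& nth 0 b i <= nth 0 v i, nth 0 v i <= (nth 0 b i).+1
                & nth 0 b i < k])%N (iota 0 N).

Definition grid N v : bool := (size v == N) && all (fun a => a <= k)%N v.

Definition face N i c v : bool := grid N v && (nth 0%N v i == c).

(* The sum of phi over the simplices of the Freudenthal-Kuhn triangulation of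
   the grid {0, ..., k}^N, obtained by iterating the prism construction. *)
Fixpoint cube_sum N phi : bool :=
  if N is N'.+1 then
    \big[addb/false]_(a < k)
      cube_sum N' (prism (rcons^~ (a : nat)) (rcons^~ a.+1) phi)
  else phi [:: [::]].

Lemma cube_sumD N phi psi :
  cube_sum N (fun s => phi s (+) psi s) = cube_sum N phi (+) cube_sum N psi.
Proof.
elim: N phi psi => [//|N IH] phi psi /=.
rewrite -big_split; apply: eq_bigr => a _ /=.
rewrite -IH; congr cube_sum; apply/funext => s; exact: prismD.
Qed.

Lemma cube_sum_true N phi : cube_sum N phi ->
  exists b s, phi s /\ {in s, forall v, cell N b v}.
Proof.
elim: N phi => [|N IH] phi /= H.
  by exists [::], [:: [::]]; split => // v; rewrite inE => /eqP ->.
have [a Ha] : exists a : 'I_k,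
    cube_sum N (prism (rcons^~ (a : nat)) (rcons^~ a.+1) phi).
  apply: contrapT => /forallNP Hn; move: H; rewrite big1 // => a _.
  exact/negbTE/negP/Hn.
have [b [s [/prism_true[t pt ts] sb]]] := IH _ Ha.
(* [mkseq] rather than [rcons], since the length of [b] is unknown. *)
exists (mkseq (fun i => if i == N then (a : nat) else nth 0%N b i) N.+1), t.
split=> // v /ts; rewrite mem_cat => H'.
have [w [c [ws -> ac]]] : exists w c, [/\ w \in s, v = rcons w c & a <= c <= a.+1]%N.
  by case/orP: H' => /mapP[w ws ->]; exists w; eexists; split => //;
    rewrite leqnn leqnSn.
have /andP[/eqP sw /allP cw] := sb _ ws.
rewrite /cell size_rcons sw eqxx andTb; apply/allP => i.
rewrite mem_iota add0n /= => iN; rewrite nth_mkseq // nth_rcons sw.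
move: iN; rewrite ltnS leq_eqVlt => /orP[/eqP ->|iN].
  by rewrite ltnn eqxx ltn_ord andbT.
by rewrite iN ltn_eqF // cw // mem_iota.
Qed.

Lemma cell_grid N b v : cell N b v -> grid N v.
Proof.
move=> /andP[/eqP sv /allP cv]; rewrite /grid sv eqxx /=.
apply/(all_nthP 0%N) => i; rewrite sv => iN.
have := cv i; rewrite mem_iota => /(_ iN) /and3P[_ vb bk].
exact: leq_trans vb bk.
Qed.

Lemma grid_rcons N v c : grid N v -> (c <= k)%N -> grid N.+1 (rcons v c).
Proof.
by move=> /andP[/eqP sv av] ck; rewrite /grid size_rcons sv eqxx all_rcons ck.
Qed.

Lemma face_rcons N i a c v : (i < N)%N -> (a <= k)%N ->
  face N i c v -> face N.+1 i c (rcons v a).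
Proof.
move=> iN ak /andP[gv vi]; rewrite /face grid_rcons //= nth_rcons.
by have /andP[/eqP -> _] := gv; rewrite iN.
Qed.

Lemma face_rcons_last N c v : (c <= k)%N -> grid N v -> face N.+1 N c (rcons v c).
Proof.
move=> ck gv; rewrite /face grid_rcons //= nth_rcons.
by have /andP[/eqP -> _] := gv; rewrite ltnn !eqxx.
Qed.

Lemma eq_in_cube_sum N phi psi :
  (forall s, {in s, forall v, grid N v} -> phi s = psi s) ->
  cube_sum N phi = cube_sum N psi.
Proof.
move=> e; suff : cube_sum N phi (+) cube_sum N psi = false.
  by case: (cube_sum N phi); case: (cube_sum N psi).
rewrite -cube_sumD; apply/negP => /cube_sum_true[b [s [+ sb]]].
by rewrite e ?addbb // => v /sb; exact: cell_grid.
Qed.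

(* The first hypothesis is the statement of cube_sum_coboundary for N, whose
   inductive step this lemma provides. *)
Lemma cube_sum_coboundaryS N psi :
  (forall P, P [::] = false ->
    (forall i c s, (i < N)%N -> c = 0%N \/ c = k ->
       {in s, forall v, face N i c v} -> P s = false) ->
    cube_sum N (coboundary P) = false) ->
  (forall i c s, (i < N)%N -> c = 0%N \/ c = k ->
       {in s, forall v, face N.+1 i c v} -> psi s = false) ->
  cube_sum N.+1 (coboundary psi) =
  cube_sum N (psi \o map (rcons^~ k)) (+) cube_sum N (psi \o map (rcons^~ 0%N)).
Proof.
move=> IH psi0 /=.
(* [S a] is the sum over the slice at height [a]; inner slices occur twice and cancel. *)
pose S a := cube_sum N (psi \o map (rcons^~ a)).
transitivity (\big[addb/false]_(a < k) (S a.+1 (+) S a)).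
  apply: eq_bigr => a _.
  transitivity (cube_sum N (fun s => psi (map (rcons^~ a.+1) s) (+)
     psi (map (rcons^~ (a : nat)) s) (+)
     coboundary (prism (rcons^~ (a : nat)) (rcons^~ a.+1) psi) s)).
    by congr cube_sum; apply/funext => s; rewrite prism_coboundary.
  (* Side walls contribute nothing: prisms over a face stay in a face, where [psi] vanishes. *)
  rewrite !cube_sumD IH ?addbF // => i c s iN ck sf.
  apply/negP => /prism_true[t + ts]; rewrite (psi0 i c) // => v /ts.
  rewrite mem_cat => /orP[] /mapP[w /sf wf ->]; apply: face_rcons => //.
  exact: ltnW.
rewrite -/(S k) -/(S 0%N).
elim: k => [|m IHm]; first by rewrite big_ord0 addbb.
by rewrite big_ord_recr /= IHm; case: (S m); case: (S _); case: (S _).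
Qed.

(** Stokes: only boundary faces survive, and [psi] vanishes there. For [N = 0] the boundary of the
    point is the empty simplex, whence the first hypothesis. *)
Lemma cube_sum_coboundary N psi : psi [::] = false ->
  (forall i c s, (i < N)%N -> c = 0%N \/ c = k ->
     {in s, forall v, face N i c v} -> psi s = false) ->
  cube_sum N (coboundary psi) = false.
Proof.
elim: N psi => [|N IH] psi psi0 psif; first by rewrite /= /coboundary /= psi0.
rewrite cube_sum_coboundaryS //; last first.
  by move=> i c s iN; apply: psif; exact: ltnW.
have E c : c = 0%N \/ c = k -> cube_sum N (psi \o map (rcons^~ c)) = false.
  move=> ck; apply/negP => /cube_sum_true[b [s [+ sb]]] /=.
  rewrite /= (psif N c) // => _ /mapP[v /sb /cell_grid gv ->].
  by apply: face_rcons_last => //; case: ck => ->.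
by rewrite !E; [|left|right].
Qed.

(** By Stokes the count reduces to facets. Each misses a required label, except the one where the
    last coordinate is 0, to which induction applies. *)
Lemma cube_sum_label_cochain N (l : seq nat -> nat) :
  (forall v, grid N v -> l v <= N)%N ->
  (forall i v, (i < N)%N -> face N i 0 v -> l v <= i)%N ->
  (forall i v, (i < N)%N -> face N i k v -> l v <> i) ->
  cube_sum N (label_cochain l N.+1).
Proof.
elim: N l => [|N IH] l lN l0 lk.
  by rewrite /=; have := lN [::] isT; rewrite leqn0 => ->.
rewrite (@eq_in_cube_sum _ _ (coboundary (label_cochain l N.+1))); last first.
  by move=> s gs; rewrite coboundary_label_cochain // => v /gs; exact: lN.
rewrite cube_sum_coboundaryS; first last.
- move=> i c s iN [->|->] sf; apply/negP => /label_cochain_true H.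
    by have [v /sf /(l0 _ _ (ltnW iN)) + lv] := H N (ltnSn N); rewrite lv leqNgt iN.
  have [v /sf + lv] := H i (ltnW iN).
  by move=> /(lk _ _ (ltnW iN)); rewrite lv.
- by move=> P P0 PN; exact: cube_sum_coboundary.
rewrite (_ : cube_sum N (_ \o map (rcons^~ k)) = false); last first.
  apply/negP => /cube_sum_true[b [s [/= /(@label_cochain_true _ _ N.+1) H sb]]].
  have [_ /mapP[v /sb /cell_grid gv ->]] := H N (ltnSn N).
  by apply: lk => //; exact: face_rcons_last.
rewrite (_ : cube_sum N _ = cube_sum N (label_cochain (l \o rcons^~ 0%N) N.+1)).
  apply: IH => [v gv|i v iN vf|i v iN vf] /=.
  - by apply: l0 => //; exact: face_rcons_last.
  - by apply: l0; [exact: ltnW|exact: face_rcons].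
  - by apply: lk; [exact: ltnW|exact: face_rcons].
by apply: eq_in_cube_sum => s _; exact: label_cochain_map.
Qed.

Lemma sperner_cube N (l : seq nat -> nat) :
  (forall v, grid N v -> l v <= N)%N ->
  (forall i v, (i < N)%N -> face N i 0 v -> l v <= i)%N ->
  (forall i v, (i < N)%N -> face N i k v -> l v <> i) ->
  exists b, forall i, (i <= N)%N -> exists2 v, cell N b v & l v = i.
Proof.
move=> lN l0 lk.
have /cube_sum_true[b [s [/label_cochain_true H sb]]] :=
  cube_sum_label_cochain lN l0 lk.
by exists b => i iN; have [v /sb vb lv] := H i iN; exists v.
Qed.
End cube.

(** * The Hilbert cube *)

Import Order.TTheory GRing.Theory Num.Theory numFieldNormedType.Exports.
Local Open Scope card_scope.
Local Open Scope ring_scope.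

(** An intrinsic description of the Hilbert cube: the first three clauses identify points with
    sequences in [0,1], the last two say that the topology is the product one. *)
Definition cube_coordinates (R : realType) (T : topologicalType)
    (c : nat -> T -> R) : Prop :=
  [/\ forall n x, 0 <= c n x <= 1,
      forall u, (forall n, 0 <= u n <= 1) -> exists x, forall n, c n x = u n,
      forall x y, (forall n, c n x = c n y) -> x = y,
      forall n, continuous (c n)
    & forall (x : T) (F : set_system T), Filter F ->
        (forall n, c n @ F --> c n x) -> F --> x].

Section hilbert_cube.
Variables (R : realType) (T : topologicalType) (c : nat -> T -> R).
Hypothesis cT : cube_coordinates c.

(** * A metric for the product topology *)

Let c01 n x : 0 <= c n x <= 1. Proof. by case: cT. Qed.

Let dist_le1 n x y : `|c n x - c n y| <= 1.
Proof.
by have := c01 n x; have := c01 n y; rewrite ler_norml; lra.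
Qed.

(** The weights make all but finitely many coordinates negligible at each scale. *)
Definition cube_dist x y : R :=
  sup (range (fun n => `|c n x - c n y| / n.+1%:R)).

Lemma cube_dist_le x y e :
  (forall n, `|c n x - c n y| / n.+1%:R <= e) -> cube_dist x y <= e.
Proof.
move=> H; apply: ge_sup; first by exists (`|c 0%N x - c 0%N y| / 1%:R), 0%N.
by move=> _ [n _ <-].
Qed.

Lemma ge_cube_dist x y n : `|c n x - c n y| / n.+1%:R <= cube_dist x y.
Proof.
apply: ub_le_sup; last by exists n.
exists 1 => _ [m _ <-]; rewrite ler_pdivrMr ?ltr0n // mul1r.
by rewrite (le_trans (dist_le1 _ _ _)) // ler1n.
Qed.

Lemma coord_cube_dist x y n : `|c n x - c n y| <= cube_dist x y * n.+1%:R.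
Proof. by rewrite -ler_pdivrMr ?ltr0n // ge_cube_dist. Qed.

Lemma cube_distC x y : cube_dist x y = cube_dist y x.
Proof.
by congr sup; apply/seteqP; split=> _ [n _ <-]; exists n; rewrite // distrC.
Qed.

Lemma cube_dist_triangle x y z :
  cube_dist x z <= cube_dist x y + cube_dist y z.
Proof.
apply: cube_dist_le => n.
rewrite (le_trans _ (lerD (ge_cube_dist x y n) (ge_cube_dist y z n))) //.
by rewrite -mulrDl ler_wpM2r // ?invr_ge0 // ler_distD.
Qed.

Lemma cube_dist0 x y : cube_dist x y = 0 <-> x = y.
Proof.
split=> [d0|->].
  case: cT => _ _ inj _ _; apply: inj => n; apply/eqP.
  by rewrite -subr_eq0 -normr_le0 (le_trans (coord_cube_dist x y n)) // d0 mul0r.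
apply/eqP; rewrite eq_le cube_dist_le /= => [|n]; last by rewrite subrr normr0 mul0r.
by rewrite (le_trans _ (ge_cube_dist y y 0)) // subrr normr0 mul0r.
Qed.

Lemma nbhs_cube_dist_lt x e : 0 < e -> nbhs x [set y | cube_dist x y < e].
Proof.
move=> e0; have e20 : 0 < e / 2 by rewrite divr_gt0.
have [N Ne] := ltr_add_invr e20; rewrite add0r in Ne.
have : \forall y \near x, forall i : 'I_N, `|c i x - c i y| < e / 2.
  apply: filter_forall => i.
  have [_ _ _ cc _] := cT; have /cvgrPdist_lt := cc i x.
  exact.
apply: filterS => y H /=.
apply: (@le_lt_trans _ _ (e / 2)); last by rewrite ltr_pdivrMr // ltr_pMr // ltr1n.
apply: cube_dist_le => n; have [nN|Nn] := ltnP n N.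
  rewrite ler_pdivrMr ?ltr0n // (le_trans (ltW (H (Ordinal nN)))) //.
  by rewrite ler_pMr // ler1n.
rewrite (le_trans _ (ltW Ne)) // -[leRHS]mul1r ler_pM // ?invr_ge0 //.
by rewrite lef_pV2 ?posrE ?ltr0n // ler_nat.
Qed.

Lemma nbhs_cube_distP x (A : set T) :
  nbhs x A <-> exists2 e : R, 0 < e & [set y | cube_dist x y < e] `<=` A.
Proof.
split=> [xA|[e e0 eA]]; last first.
  exact: filterS eA (nbhs_cube_dist_lt x e0).
(* The balls around [x] form a filter converging to [x] coordinatewise, hence in [T]. *)
pose F := filter_from [set e : R | 0 < e] (fun e => [set y | cube_dist x y < e]).
have FF : Filter F.
  apply: filter_from_filter; first by exists 1; rewrite /= ltr01.
  move=> e f /= e0 f0; exists (Num.min e f); first by rewrite /= lt_min e0.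
  by move=> y /=; rewrite lt_min => /andP[].
have [_ _ _ _ /(_ x F FF) Fx] := cT.
have [e e0 eA] : F A; last by exists e.
apply: Fx xA => n; apply/cvgrPdist_lt => e e0.
exists (e / n.+1%:R); first by rewrite /= divr_gt0 // ltr0n.
move=> y /= ye; apply: le_lt_trans (coord_cube_dist x y n) _.
by rewrite -ltr_pdivlMr // ltr0n.
Qed.

Lemma cube_metrizable : metrizable R T.
Proof.
exists cube_dist; split.
- exact: cube_dist0.
- exact: cube_distC.
- by move=> x y z; exact: cube_dist_triangle.
- exact: nbhs_cube_distP.
Qed.

(* Equal to 0, a, 1 according as a <= 0, 0 <= a <= 1, 1 <= a. *)
Definition clamp (a : R) : R := (`|a| - `|a - 1| + 1) / 2.

Lemma clamp01 a : 0 <= clamp a <= 1.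
Proof.
rewrite /clamp; case: (ger0P a) => a0; case: (ger0P (a - 1)) => a1; lra.
Qed.

Lemma clamp_id a : 0 <= a <= 1 -> clamp a = a.
Proof.
by move=> /andP[a0 a1]; rewrite /clamp ger0_norm // ler0_norm; lra.
Qed.

Lemma continuous_clamp : continuous clamp.
Proof.
move=> a; apply: cvgM; last exact: cvg_cst.
apply: cvgD; last exact: cvg_cst.
apply: cvgB; first exact: cvg_norm.
by apply: cvg_norm; apply: cvgB; [exact: cvg_id | exact: cvg_cst].
Qed.

(** Lets maps into [T] be defined by arbitrary real sequences, with no bounds to check. *)
Lemma cube_retraction :
  exists r : (nat -> R) -> T, forall n u, c n (r u) = clamp (u n).
Proof.
have [|r rE] := @choice _ _ (fun u x => forall n, c n x = clamp (u n)).
  by move=> u; case: cT => _ + _ _ _; apply=> n; exact: clamp01.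
by exists r.
Qed.

Lemma continuous_to_cube (U : topologicalType) (f : U -> T) :
  (forall n, continuous (c n \o f)) -> continuous f.
Proof.
move=> cf x; case: cT => _ _ _ _; apply => n.
exact: cf.
Qed.

Lemma cube_compact : compact [set: T].
Proof.
have [r rE] := cube_retraction.
pose K := [set u : {ptws nat -> R} | forall n, `[0, 1]%classic (u n)].
have cK : compact K.
  exact: (@tychonoff nat (fun=> R : topologicalType)
    (fun=> `[0, 1]%classic) (fun=> @segment_compact R 0 1)).
have cr : continuous (r : {ptws nat -> R} -> T).
  apply: continuous_to_cube => n u.
  rewrite (_ : c n \o r = clamp \o proj n); last by apply/funext => v /=; rewrite rE.
  apply: (@continuous_comp {ptws nat -> R} R R (proj n) clamp u).
    exact: (@proj_continuous nat (fun=> R : topologicalType) n u).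
  exact: continuous_clamp.
rewrite (_ : [set: T] = r @` K).
  exact: continuous_compact (continuous_subspaceT cr) cK.
apply/seteqP; split=> // x _; exists (c ^~ x) => [n|] /=.
  by rewrite in_itv /= c01.
by case: cT => _ _ + _ _; apply => n; rewrite rE clamp_id.
Qed.

Lemma cube_connected : connected [set: T].
Proof.
have [r rE] := cube_retraction.
(* [f y] runs along the segment from the origin to [y]; these segments cover [T] and share the
   origin. *)
pose f y (s : R) := r (fun n => s * c n y).
rewrite (_ : [set: T] = \bigcup_(y in setT) (f y @` `[0, 1]%classic)).
  apply: bigcup_connected => [|y _].
    exists (r (fun=> 0)) => y _; exists 0; first by rewrite /= in_itv /= lexx ler01.
    by congr r; apply/funext => n; rewrite mul0r.
  apply: connected_continuous_connected; first exact: segment_connected.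
  apply: continuous_subspaceT; apply: continuous_to_cube => n.
  rewrite (_ : _ \o _ = clamp \o ( *%R^~ (c n y))); last first.
    by apply/funext => s /=; rewrite rE.
  move=> s; apply: continuous_comp; last exact: continuous_clamp.
  by apply: cvgM; [exact: cvg_id|exact: cvg_cst].
apply/seteqP; split=> // y _; exists y => //; exists 1.
  by rewrite /= in_itv /= lexx ler01.
case: cT => _ _ + _ _; apply => n.
by rewrite rE mul1r clamp_id.
Qed.

Lemma cube_continuum : continuum R T.
Proof.
split; [exact: cube_metrizable|exact: cube_compact|exact: cube_connected].
Qed.

(** * The Lebesgue covering theorem *)

Lemma lebesgue_number (V : set (set T)) : open_cover V ->
  exists2 e : R, 0 < e &
    forall x, exists2 B, V B & [set y | cube_dist x y < e] `<=` B.
Proof.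
move=> [Vo Vc].
pose P e x := exists2 B, V B & [set y | cube_dist x y < e] `<=` B.
have H : \forall e \near 0^'+, [set: T] `<=` P e.
  apply: ((compact_near_coveringP _).1 cube_compact).
  move=> x _; have : (\bigcup_(A in V) A) x by rewrite Vc.
  move=> [B VB Bx]; have /nbhs_cube_distP[e e0 eB] : nbhs x B.
    by apply: open_nbhs_nbhs; split => //; exact: Vo.
  have e20 : 0 < e / 2 by rewrite divr_gt0.
  exists ([set y | cube_dist x y < e / 2], [set d | d < e / 2]).
    by split; [exact: nbhs_cube_dist_lt | exact: nbhs_right_lt].
  move=> [y d] /= [xy de]; exists B => // z /= yz; apply: eB => /=.
  have := cube_dist_triangle x y z; lra.
have [e [e0 He]] := filter_ex (filterI (nbhs_right_gt (0 : R)) H).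
by exists e => // x; exact: He.
Qed.

(** Capping at [k] keeps the coordinates in [0,1] for every [v]; the default entry 0 fills those
    past the end of [v]. *)
Definition grid_point k (v : seq nat) (n : nat) : R :=
  (minn (nth 0%N v n) k)%:R / k%:R.

Lemma covering_multiplicity (V : set (set T)) n (e : R) : 0 < e ->
  (forall x, exists2 B, V B & [set y | cube_dist x y < e] `<=` B) ->
  (forall B i, V B -> (i < n)%N ->
     (forall x, B x -> c i x != 0) \/ (forall x, B x -> c i x != 1)) ->
  exists x, `I_n.+1 #<= [set B | V B /\ B x].
Proof.
move=> e0 Ve Vn.
(* The grid will have [k.+1] steps in each direction, so that its mesh is below [e]. *)
have [k ke] := ltr_add_invr e0; rewrite add0r in ke.
have /choice[p pE] : forall v, exists x, forall i, c i x = grid_point k.+1 v i.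
  move=> v; case: cT => _ + _ _ _; apply => i.
  by rewrite /grid_point divr_ge0 //= ler_pdivrMr ?ltr0n // mul1r ler_nat geq_minr.
have /choice[b bE] : forall v, exists B,
    V B /\ [set y | cube_dist (p v) y < e] `<=` B.
  by move=> v; have [B] := Ve (p v); exists B.
have bp v : b v (p v) by apply: (bE v).2 => /=; rewrite (cube_dist0 _ _).2.
(* [find] returns [n] when no direction qualifies. The label depends on the member alone, so
   distinct labels come from distinct members. *)
pose label B := find (fun i => `[< exists2 x, B x & c i x = 0 >]) (iota 0 n).
have labelP v i : (i < n)%N -> (exists2 x, b v x & c i x = 0) ->
    (label (b v) <= i)%N.
  move=> iN H; rewrite leqNgt; apply/negP => /(before_find 0%N).
  by rewrite nth_iota // add0n => /asboolP.
have [||| w wE] := @sperner_cube k.+1 n (label \o b).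
- move=> v _ /=; rewrite (leq_trans (find_size _ _)) // size_iota //.
- move=> i v iN /andP[_ /eqP v0] /=; apply: labelP => //; exists (p v) => //.
  by rewrite pE /grid_point v0 min0n mul0r.
(* Label [i] would make the member meet both opposite faces in direction [i]. *)
- move=> i v iN /andP[_ /eqP v1] /= lv.
  have : has (fun i => `[< exists2 x, b v x & c i x = 0 >]) (iota 0 n).
    by rewrite has_find size_iota -/(label (b v)) lv.
  move=> /(nth_find 0%N); rewrite -/(label (b v)) lv nth_iota // add0n.
  move=> /asboolP[x bx cx]; have [H|H] := Vn (b v) i (bE v).1 iN.
    by have := H x bx; rewrite cx eqxx.
  have := H _ (bp v); rewrite pE /grid_point v1 minnn divff ?eqxx //.
  by rewrite pnatr_eq0.
have /choice[q qE] : forall i : nat, exists v, (i <= n)%N ->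
    cell k.+1 n w v /\ label (b v) = i.
  move=> i; case: (leqP i n) => [/wE[v ? ?]|_]; last by exists [::].
  by exists v.
exists (p (q 0%N)).
(* Vertices of a cell differ by at most one step in the first [n] coordinates and agree in the
   others, so every member chosen in the cell contains [p (q 0)]. *)
have cell_close v v' : cell k.+1 n w v -> cell k.+1 n w v' ->
    cube_dist (p v) (p v') < e.
  move=> /andP[/eqP sv /allP vw] /andP[/eqP sv' /allP vw'].
  apply: le_lt_trans ke; apply: cube_dist_le => i.
  rewrite ler_pdivrMr ?ltr0n // (@le_trans _ _ k.+1%:R^-1) //; last first.
    by rewrite ler_peMr ?invr_ge0 // ler1n.
  rewrite !pE /grid_point -mulrBl normrM normfV normr_nat.
  rewrite -[leRHS]mul1r ler_wpM2r ?invr_ge0 //.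
  have [vv v'v] : (nth 0 v i <= (nth 0 v' i).+1 /\ nth 0 v' i <= (nth 0 v i).+1)%N.
    have [ni|iN] := leqP n i; first by rewrite !nth_default ?sv ?sv'.
    have := vw i; have := vw' i; rewrite mem_iota /= add0n iN; lia.
  set x := minn _ _; set y := minn _ _.
  have [xy yx] : (x <= y.+1 /\ y <= x.+1)%N by rewrite /x /y; lia.
  move: xy yx; rewrite -!(ler_nat R) -!natr1 => xy yx.
  by rewrite ler_norml; lra.
have qI : {in `I_n.+1 &, injective (b \o q)}.
  move=> i j /set_mem /= iN /set_mem /= jN bij.
  by rewrite -(qE i iN).2 -(qE j jN).2 bij.
rewrite -(card_le_eql (inj_card_eq qI)); apply: subset_card_le => _ [i /= iN <-].
by split; [exact: (bE _).1 | apply: (bE _).2; apply: cell_close; apply: (qE _ _).1].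
Qed.

Lemma cube_infinite_dimensional : infinite_dimensional T.
Proof.
move=> n dimT.
(* Each box omits one of the two opposite faces in each of [n.+1] directions. *)
pose box (d : {ffun 'I_n.+1 -> bool}) : set T :=
  [set x | forall i : 'I_n.+1, c i x != (d i)%:R].
have box_open d : open (box d).
  rewrite openE => x dx; apply: filter_forall => i.
  have : open (c i @^-1` [set a : R | a != (d i)%:R]).
    apply: open_comp; last exact: open_neq.
    by move=> y _; case: cT => _ _ _ + _; apply.
  by move=> oi; apply: open_nbhs_nbhs; split => //; exact: dx.
have [] := dimT (range box); first exact: finite_image finite_finset.
  split=> [_ [d _ <-]|]; first exact: box_open.
  apply/seteqP; split=> // x _.
  exists (box [ffun i : 'I_n.+1 => c i x == 0]) => [|i]; first by eexists.
  by rewrite ffunE; have [->|//] := eqVneq (c i x) 0; rewrite eq_sym oner_eq0.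
move=> V [_ Vo Vbox Vn].
have [e e0 Ve] := lebesgue_number Vo.
(* The [n.+1] directions force [n.+2] members through one point, against the bound [n.+1]. *)
have [|x xV] := @covering_multiplicity V n.+1 e e0 Ve.
  move=> B i VB ni; have [_ [d _ <-] Bd] := Vbox B VB.
  case dE : (d (Ordinal ni)); [right|left] => x /Bd /(_ (Ordinal ni)) /=;
    by rewrite dE.
by have := card_le_trans xV (Vn x); rewrite card_le_II ltnn.
Qed.

End hilbert_cube.

(** * The orbit set as a Hilbert cube *)

Lemma cvg_ptws (X : topologicalType) (F : set_system {ptws nat -> X})
    (x : {ptws nat -> X}) : Filter F ->
  (forall n, (fun y : {ptws nat -> X} => y n) @ F --> x n) -> F --> x.
Proof.
move=> FF Fx; apply/cvg_sup => n U [_ [[W oW <-] Wx WU]].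
apply: filterS WU _; apply: Fx; exact: open_nbhs_nbhs.
Qed.

Lemma cvg_set_type (X : topologicalType) (A : set X) (F : set_system A) (x : A) :
  Filter F -> set_val @ F --> set_val x -> F --> x.
Proof.
move=> FF Fx U [_ [[W oW <-] Wx WU]].
apply: filterS WU _; apply: Fx; exact: open_nbhs_nbhs.
Qed.

(** The first term of an orbit is fixed at [t] and all later ones are free, hence the shift to
    [n.+1]. *)
Lemma orbit_set_setT_coordinates (R : realType) (t : unit_interval R) :
  cube_coordinates (fun n (x : orbit_set (fun=> [set: unit_interval R]) t) =>
     set_val (set_val x n.+1) : R).
Proof.
split.
- move=> n x; have := set_valP (set_val x n.+1).
  by rewrite /= in_itv.
- move=> u u01.
  have u01' n : u n \in `[0, 1]%classic by rewrite inE /= in_itv /=.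
  pose y : {ptws nat -> unit_interval R} :=
    fun n => if n is m.+1 then SigSub (u01' m) else t.
  have yO : y \in orbit_set (fun=> setT) t by rewrite inE.
  by exists (SigSub yO).
- move=> x y xy; apply: val_inj; apply/funext => -[|n].
    have [-> _] := set_valP x.
    by have [-> _] := set_valP y.
  by apply: val_inj; exact: xy.
- move=> n x; set O := orbit_set _ _.
  apply: (@continuous_comp O (unit_interval R) R
    (fun y => set_val y n.+1) set_val x).
    apply: (@continuous_comp O {ptws nat -> unit_interval R} _
      set_val (proj n.+1) x).
      exact: initial_continuous.
    exact: proj_continuous.
  exact: initial_continuous.
- move=> x F FF Fx; apply: cvg_set_type; apply: cvg_ptws => -[|n].
    (* The first term is constant, so its convergence is automatic. *)
    have yt (y : orbit_set (fun=> [set: unit_interval R]) t) : set_val y 0%N = t.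
      by have [] := set_valP y.
    rewrite yt => U /nbhs_singleton Ut; apply: (@filterS _ F FF setT) => [y _|].
    by suff : U (set_val y 0%N) by []; rewrite yt.
    exact: filterT.
  by apply: cvg_set_type; exact: Fx.
Qed.

Theorem proposition4p3 (R : realType) :
  exists (F : unit_interval R -> set (unit_interval R)) (t : unit_interval R),
    [/\ forall x, hyperspace (F x),
        upper_semicontinuous F,
        continuum R (set_type (orbit_set F t))
      & infinite_dimensional (set_type (orbit_set F t))].
Proof.
have in01 : (0 : R) \in `[0, 1]%classic by rewrite inE /= in_itv /= lexx ler01.
pose t : unit_interval R := SigSub in01.
exists (fun=> setT), t; have cO := orbit_set_setT_coordinates t; split.
- by move=> x; split; [exact: closedT | exists t].
- by move=> x V _ TV; exists setT; split; [exact: openT | |].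
- exact: cube_continuum cO.
- exact: cube_infinite_dimensional cO.
Qed.
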